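(* Consider an instance of the nested $p$-center problem with the minimizing the maximum relative regret objective and the mixed-integer linear program (nPCR2) given in the context. Let $LB\ge0$ be a valid lower bound on the optimal objective function value of this problem. Then for any $i\in\mathcal I$, $j\in\mathcal J$ and $h\in\mathcal H$ the inequality $$w\ \ge\ \frac{1}{d^{h*}}\Bigl(\max\{LB\,d^{h*},d_{ij}\}-\sum_{j'\in\mathcal J:\,d_{ij'}<d_{ij}}\bigl(\max\{LB\,d^{h*},d_{ij}\}-\max\{LB\,d^{h*},d_{ij'}\}\bigr)\,y_{j'}^h\Bigr)-1$$ is valid for (nPCR2), i.e., every feasible solution of (nPCR2) fulfills it.
   Context: Instance: $\mathcal I$ is a finite nonempty set of customer demand points, $\mathcal J$ a finite nonempty set of potential facility locations, with distances $d_{ij}\ge 0$. The time horizon is $\mathcal H=\{1,\dots,H\}$, and $p^1,\dots,p^H$ are positive integers with $p^h\le p^{h+1}$ for $h=1,\dots,H-1$ and $p^H\le|\mathcal J|$. For nonempty $S\subseteq\mathcal J$ let $d(S)=\max_{i\in\mathcal I}\min_{j\in S}d_{ij}$. Let $d^{h*}=\min\{d(S):S\subseteq\mathcal J,\ |S|=p^h\}$ be the optimal value of the $p$-center problem for $p=p^h$, assumed positive for all $h\in\mathcal H$. A feasible solution $(\mathcal J^1,\dots,\mathcal J^H)$ consists of sets $\mathcal J^h\subseteq\mathcal J$ with $|\mathcal J^h|=p^h$ for $h\in\mathcal H$ and $\mathcal J^h\subseteq\mathcal J^{h+1}$ for $h=1,\dots,H-1$. The nested $p$-center problem with the minimizing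 the maximum relative regret objective asks for a feasible solution minimizing $\max_{h\in\mathcal H}\frac{d(\mathcal J^h)-d^{h*}}{d^{h*}}$. (nPCR2) is the mixed-integer linear program: minimize $w$ subject to - $\sum_{j\in\mathcal J}y_j^h=p^h$ for all $h\in\mathcal H$; - $w\ge\frac{1}{d^{h*}}\bigl(d_{ij}-\sum_{j'\in\mathcal J:\,d_{ij'}<d_{ij}}(d_{ij}-d_{ij'})\,y_{j'}^h\bigr)-1$ for all $i\in\mathcal I$, $j\in\mathcal J$, $h\in\mathcal H$; - $y_j^h\ge y_j^{h-1}$ for all $j\in\mathcal J$, $h\in\mathcal H\setminus\{1\}$; - $y_j^h\in\{0,1\}$ for all $j\in\mathcal J$, $h\in\mathcal H$, and $w\in\mathbb R_{\ge0}$. *)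

(* Defs.v *)
From HB Require Import structures.
From mathcomp Require Import all_boot all_order all_algebra.

Set Implicit Arguments.
Unset Strict Implicit.
Unset Printing Implicit Defensive.

Import Order.TTheory GRing.Theory Num.Theory.
Local Open Scope ring_scope.

(* The periods 1, ..., H are encoded by 'I_H (period h is the
   ordinal of value h - 1), so h' is the period following h iff
   h' = h.+1 :> nat. *)

(* Minimum and maximum of f over a nonempty A; both are 0 by convention
   when A is empty. *)
Definition min_over (R : realFieldType) (T : finType) (A : {set T})
    (f : T -> R) : R :=
  if [pick x in A] is Some x0 then f [arg min_(x < x0 in A) f x]%O else 0.

Definition max_over (R : realFieldType) (T : finType) (A : {set T})
    (f : T -> R) : R :=
  if [pick x in A] is Some x0 then f [arg max_(x > x0 in A) f x]%O else 0.

Section NestedPCenter.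

Variables (R : realFieldType) (I J : finType) (d : I -> J -> R).
Variables (H : nat) (p : 'I_H -> nat).

Definition radius (S : {set J}) : R :=
  max_over [set: I] (fun i => min_over S (d i)).

Definition pcenter_opt (k : nat) : R :=
  min_over [set S : {set J} | #|S| == k] radius.

Definition dstar (h : 'I_H) : R := pcenter_opt (p h).

Definition nested_feasible (s : {ffun 'I_H -> {set J}}) : bool :=
  [forall h, #|s h| == p h] &&
  [forall h : 'I_H, forall h' : 'I_H,
     (h' == h.+1 :> nat) ==> (s h \subset s h')].

Definition max_rel_regret (s : {ffun 'I_H -> {set J}}) : R :=
  max_over [set: 'I_H] (fun h => (radius (s h) - dstar h) / dstar h).

Definition nested_opt : R :=
  min_over [set s | nested_feasible s] max_rel_regret.

Record nPCR2_feasible (y : 'I_H -> J -> R) (w : R) : Prop := NPCR2Feasible {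
  nPCR2_card : forall h, \sum_(j : J) y h j = (p h)%:R;
  nPCR2_regret : forall (i : I) (j : J) (h : 'I_H),
    w >= 1 / dstar h *
           (d i j - \sum_(j' : J | d i j' < d i j) (d i j - d i j') * y h j')
         - 1;
  nPCR2_nested : forall (j : J) (h h' : 'I_H),
    h' = h.+1 :> nat -> y h' j >= y h j;
  nPCR2_binary : forall (j : J) (h : 'I_H), y h j = 0 \/ y h j = 1;
  nPCR2_nonneg : 0 <= w
}.

End NestedPCenter.

(* Main.v *)
Require Import Defs.
From HB Require Import structures.
From mathcomp Require Import all_boot all_order all_algebra.

Set Implicit Arguments.
Unset Strict Implicit.
Unset Printing Implicit Defensive.

Import Order.TTheory GRing.Theory Num.Theory.
Local Open Scope ring_scope.

(** In (nPCR2) the constraint of a triple (i, j, h) bounds w from below by the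
    regret of a distance d i j from which the gains d i j - d i j' of the closer
    open facilities j' are removed. Two facts carry the proof.

    For j the open facility nearest to i in period h no gain is left, so the
    constraint says d i j <= (1 + w) * dstar h ([nearest_open_le]). Taking the
    worst customer and the worst period, w is at least the maximum relative
    regret of the nested solution encoded by y, hence w >= nested_opt >= LB
    ([nested_opt_le]).

    Conversely, for any nondecreasing g and any open facility j0, the expression
    g (d i j) minus the gains measured through g is at most g (d i j0)
    ([sub_gains_le]). The strengthened inequality is the case where
    g t = max (LB * dstar h) t and j0 is nearest to i: the value g (d i j0)
    is at most (1 + w) * dstar h because both arguments of the maximum are. *)

Section Extrema.
Variables (R : realFieldType) (T : finType) (A : {set T}) (f : T -> R).

Lemma min_over_attained :
  A != set0 -> exists2 x, x \in A & min_over A f = f x.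
Proof.
move=> /set0Pn[a aA]; rewrite /min_over; case: pickP => [b bA|/(_ a)].
  by case: arg_minP => // x xA _; exists x.
by rewrite aA.
Qed.

Lemma min_over_le x : x \in A -> min_over A f <= f x.
Proof.
move=> xA; rewrite /min_over; case: pickP => [b bA|/(_ x)]; last by rewrite xA.
by case: arg_minP => // z _; apply.
Qed.

Lemma max_over_attained :
  A != set0 -> exists2 x, x \in A & max_over A f = f x.
Proof.
move=> /set0Pn[a aA]; rewrite /max_over; case: pickP => [b bA|/(_ a)].
  by case: arg_maxP => // x xA _; exists x.
by rewrite aA.
Qed.

End Extrema.

(** If j0 counts among the gains, its own gain, of weight 1, already lowers the
    left-hand side to [g (c j0)] and the other gains are nonnegative; otherwise
    [c j <= c j0] and monotonicity of g suffices. *)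
Lemma sub_gains_le (R : realFieldType) (J : finType) (c y : J -> R)
    (g : R -> R) (j j0 : J) :
  {homo g : a b / a <= b} -> (forall k, 0 <= y k) -> y j0 = 1 ->
  g (c j) - \sum_(k | c k < c j) (g (c j) - g (c k)) * y k <= g (c j0).
Proof.
move=> g_mono y_ge0 y_j0.
have gain_ge0 k : c k < c j -> 0 <= (g (c j) - g (c k)) * y k.
  by move=> /ltW ckj; rewrite mulr_ge0 // subr_ge0 g_mono.
have [j0_closer|j_closer] := ltP (c j0) (c j); last first.
  by rewrite lerBlDr (le_trans (g_mono _ _ j_closer)) // lerDl sumr_ge0.
rewrite (bigD1 j0) //= y_j0 mulr1 opprD addrA subKr lerBlDr lerDl.
by apply: sumr_ge0 => k /andP[/gain_ge0].
Qed.

Section Feasible.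
Variables (R : realFieldType) (I J : finType) (d : I -> J -> R).
Variables (H : nat) (p : 'I_H -> nat) (y : 'I_H -> J -> R) (w : R).
Hypothesis p_gt0 : forall h, (0 < p h)%N.
Hypothesis dstar_gt0 : forall h, 0 < dstar d p h.
Hypothesis yw_feasible : nPCR2_feasible d p y w.

Let open : {ffun 'I_H -> {set J}} := [ffun h => [set j | y h j == 1]].

Lemma in_open h j : (j \in open h) = (y h j == 1).
Proof. by rewrite ffunE inE. Qed.

Lemma closed_eq0 h j : j \notin open h -> y h j = 0.
Proof.
rewrite in_open; case: (nPCR2_binary yw_feasible j h) => // ->.
by rewrite eqxx.
Qed.

Lemma card_open h : #|open h| = p h.
Proof.
apply/eqP; rewrite -(eqr_nat R) -(nPCR2_card yw_feasible h) -sum1_card natr_sum.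
rewrite big_mkcond /=; apply/eqP/eq_bigr => j _.
by case: ifPn => [|/closed_eq0->//]; rewrite in_open => /eqP->.
Qed.

Lemma open_neq0 h : open h != set0.
Proof. by rewrite -card_gt0 card_open. Qed.

Lemma open_nested_feasible : nested_feasible p open.
Proof.
apply/andP; split; first by apply/forallP => h; rewrite card_open.
apply/forallP => h; apply/forallP => h'; apply/implyP => /eqP hh'.
apply/subsetP => j; apply: contraLR => /closed_eq0 yh'0.
have := nPCR2_nested yw_feasible j hh'; rewrite yh'0 in_open.
by apply: contraTneq => ->; rewrite ler10.
Qed.

(** In the constraint of the nearest open facility, every facility in the sum is
    strictly closer and hence closed, so the sum vanishes. *)
Lemma nearest_open_le i h : min_over (open h) (d i) <= (1 + w) * dstar d p h.
Proof.
have [j _ min_j] := min_over_attained (d i) (open_neq0 h).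
have := nPCR2_regret yw_feasible i j h; rewrite big1 => [|k k_closer].
  by rewrite subr0 min_j mul1r mulrC lerBlDl ler_pdivrMr.
rewrite closed_eq0 ?mulr0 //; apply/negP => /(min_over_le (d i)).
by rewrite min_j leNgt k_closer.
Qed.

Lemma radius_open_le h : (0 < #|I|)%N ->
  radius d (open h) <= (1 + w) * dstar d p h.
Proof.
move=> I_gt0; have I_neq0 : [set: I] != set0 by rewrite -card_gt0 cardsT.
rewrite /radius.
have [i _ ->] := max_over_attained (fun i => min_over (open h) (d i)) I_neq0.
exact: nearest_open_le.
Qed.

(** The open facilities form a nested solution, and w dominates its relative
    regret at every customer and period; optimality gives the rest. *)
Lemma nested_opt_le : (0 < #|I|)%N -> (0 < H)%N -> nested_opt d p <= w.
Proof.
move=> I_gt0 H_gt0.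
have open_in : open \in [set s | nested_feasible p s].
  by rewrite inE open_nested_feasible.
apply: le_trans (min_over_le (max_rel_regret d p) open_in) _.
have H_neq0 : [set: 'I_H] != set0 by rewrite -card_gt0 cardsT card_ord.
rewrite /max_rel_regret.
have [h _ ->] := max_over_attained
  (fun h => (radius d (open h) - dstar d p h) / dstar d p h) H_neq0.
rewrite ler_pdivrMr // lerBlDl -[X in X + _]mul1r -mulrDl.
exact: radius_open_le.
Qed.

Lemma nearest_open_exists i h :
  exists2 j, y h j = 1 & d i j <= (1 + w) * dstar d p h.
Proof.
have [j] := min_over_attained (d i) (open_neq0 h).
rewrite in_open => /eqP yj min_j; exists j => //.
by rewrite -min_j nearest_open_le.
Qed.

End Feasible.

Theorem proposition18 (R : realFieldType) (I J : finType) (d : I -> J -> R)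
    (H : nat) (p : 'I_H -> nat)
    (I_nonempty : (0 < #|I|)%N) (J_nonempty : (0 < #|J|)%N)
    (H_gt0 : (0 < H)%N)
    (d_ge0 : forall i j, 0 <= d i j)
    (p_gt0 : forall h, (0 < p h)%N)
    (p_mono : forall h h' : 'I_H, h' = h.+1 :> nat -> (p h <= p h')%N)
    (p_last : forall h : 'I_H, h.+1 = H -> (p h <= #|J|)%N)
    (dstar_gt0 : forall h, 0 < dstar d p h)
    (LB : R) (LB_ge0 : 0 <= LB) (LB_valid : LB <= nested_opt d p)
    (i : I) (j : J) (h : 'I_H)
    (y : 'I_H -> J -> R) (w : R) (yw_feasible : nPCR2_feasible d p y w) :
  w >= 1 / dstar d p h *
         (Num.max (LB * dstar d p h) (d i j)
          - \sum_(j' : J | d i j' < d i j)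
              (Num.max (LB * dstar d p h) (d i j)
               - Num.max (LB * dstar d p h) (d i j')) * y h j')
       - 1.
Proof.
have LB_le_w : LB <= w.
  exact: le_trans LB_valid (nested_opt_le p_gt0 dstar_gt0 yw_feasible _ _).
have [j0 y_j0 d_j0] := nearest_open_exists p_gt0 dstar_gt0 yw_feasible i h.
have y_ge0 k : 0 <= y h k by case: (nPCR2_binary yw_feasible k h) => ->.
have max_mono : {homo Num.max (LB * dstar d p h) : a b / a <= b}.
  by move=> a b ab; rewrite ge_max !le_max lexx ab orbT.
rewrite lerBlDl mul1r mulrC ler_pdivrMr //.
apply: le_trans (sub_gains_le (d i) j max_mono y_ge0 y_j0) _.
by rewrite ge_max d_j0 andbT ler_pM2r // (le_trans LB_le_w) // lerDr ler01.
Qed.
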